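(* $\#\{x \text{ imaginary octonion} : \tfrac12+x\in\mathfrak{o},\ N(\tfrac12+x)=1\}=56$.
   Context: $\mathfrak{C}_{\mathbb{Q}}=\bigoplus_{i=0}^7\mathbb{Q}e_i$ is the algebra of octonions (Cayley numbers) with unit $e_0$; $\frac12$ means $\frac12e_0$. For $x=\sum_{i=0}^7x_ie_i\in\mathfrak{C}_{\mathbb{Q}}$ the norm is $N(x)=\sum_{i=0}^7x_i^2$; $x$ is called imaginary if $x_0=0$. The lattice $\mathfrak{o}\subset\mathfrak{C}_{\mathbb{Q}}$ of integral octonions is the $\mathbb{Z}$-span of $\alpha_0=e_0$, $\alpha_1=e_1$, $\alpha_2=e_2$, $\alpha_3=-e_4$, $\alpha_4=\frac12(e_1+e_2+e_3+e_4)$, $\alpha_5=\frac12(-e_0-e_1-e_4+e_5)$, $\alpha_6=\frac12(-e_0+e_1-e_2+e_6)$, $\alpha_7=\frac12(-e_0+e_2+e_4+e_7)$. *)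

(* Defs.v *)
From mathcomp Require Import all_boot all_order all_algebra.
From mathcomp Require Import all_classical.
Set Implicit Arguments.
Unset Strict Implicit.
Unset Printing Implicit Defensive.
Import Order.TTheory GRing.Theory Num.Theory.
Local Open Scope ring_scope.

(* The rational octonions, as coordinate vectors (x_0, ..., x_7) in the basis
   e_0, ..., e_7 with unit e_0. Only the Q-vector space structure, the norm
   and the unit are needed here, so no multiplication table is fixed. *)
Notation octonion := 'rV[rat]_8.

(* In [oct_e k], a numeral k is read as an element of 'I_8. *)
Definition oct_e (i : 'I_8) : octonion := delta_mx 0 i.

Definition oct_norm (x : octonion) : rat := \sum_(i < 8) x 0 i ^+ 2.

Definition imaginary (x : octonion) : Prop := x 0 0 = 0.

(* The octonion 1/2, that is (1/2) e_0. *)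
Definition oct_half : octonion := 2^-1 *: oct_e 0.

Definition oct_alpha : 8.-tuple octonion :=
  [tuple oct_e 0;
         oct_e 1;
         oct_e 2;
         - oct_e 4;
         2^-1 *: (oct_e 1 + oct_e 2 + oct_e 3 + oct_e 4);
         2^-1 *: (- oct_e 0 - oct_e 1 - oct_e 4 + oct_e 5);
         2^-1 *: (- oct_e 0 + oct_e 1 - oct_e 2 + oct_e 6);
         2^-1 *: (- oct_e 0 + oct_e 2 + oct_e 4 + oct_e 7)].

Definition integral_octonion (x : octonion) : Prop := inIntSpan oct_alpha x.

(* Main.v *)
Require Import Defs.
From mathcomp Require Import all_boot all_order all_algebra.
From mathcomp Require Import all_classical.
From mathcomp Require Import finmap zify ring lra.
Local Open Scope classical_set_scope.
Local Open Scope card_scope.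
Local Open Scope ring_scope.
Import Order.TTheory GRing.Theory Num.Theory.

(** The lattice of integral octonions is a copy of E8 obtained by Construction
    A: doubling it gives exactly the integer vectors whose reduction modulo 2
    lies in an [8,4] extended Hamming code ([integral_octonionP]). Indeed each
    of the four half-integral generators is alone in involving one of the
    coordinates 3, 5, 6, 7, which therefore fixes its coefficient; the other
    generators, e_0, e_1, e_2 and - e_4, then adjust the doubled coordinates
    0, 1, 2, 4 by arbitrary even integers, and this leaves four parity checks.

    So the octonions to be counted are the (1 + y) / 2, where the seven
    imaginary coordinates y of the double are integers of square sum 4 - 1 = 3
    and where (1, y) passes the parity checks. A square sum of 3 forces the
    coordinates into {-1, 0, 1} ([mem_sign_words_sqnorm]), so they are found
    among 3 ^ 7 words, and counting gives 56. The number is 7 * 8: a support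
    is one of the seven codewords of weight 4 that contain 0 (the lines of a
    Fano plane with 0 adjoined), and its three imaginary signs are free. *)

Definition half_row (y : seq int) : octonion := \row_(i < 8) ((y`_i)%:~R / 2).

Definition sqnorm (y : seq int) : int := foldr (fun a t => a ^+ 2 + t) 0 y.

Lemma size8P (T : Type) (x0 : T) (y : seq T) : size y = 8%N ->
  y = [:: nth x0 y 0; nth x0 y 1; nth x0 y 2; nth x0 y 3;
          nth x0 y 4; nth x0 y 5; nth x0 y 6; nth x0 y 7].
Proof. by case: y => [|? [|? [|? [|? [|? [|? [|? [|? []]]]]]]]]. Qed.

Lemma half_row_inj (y z : seq int) :
  size y = 8%N -> size z = 8%N -> half_row y = half_row z -> y = z.
Proof.
move=> sy sz e; apply: (@eq_from_nth _ 0); rewrite ?sy ?sz // => i ilt8.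
move/rowP: e => /(_ (Ordinal ilt8)); rewrite !mxE /= => e.
by apply/(@intr_inj rat)/(mulIf _ e).
Qed.

Lemma oct_norm_half_row (y : seq int) :
  size y = 8%N -> oct_norm (half_row y) = (sqnorm y)%:~R / 4.
Proof.
move/(@size8P _ 0) => ->.
rewrite /oct_norm !big_ord_recl big_ord0 !mxE /=.
by rewrite !(rmorphD, rmorphXn, rmorph0) /=; field.
Qed.

Lemma imaginary_half_row (a : int) (s : seq int) :
  imaginary (half_row (a :: s)) <-> a = 0.
Proof.
rewrite /imaginary mxE /=; split=> [/eqP|->]; last by rewrite mul0r.
by rewrite mulf_eq0 orbF intr_eq0 => /eqP.
Qed.

Lemma half_rowDhalf (a : int) (s : seq int) :
  oct_half + half_row (a :: s) = half_row (1 + a :: s).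
Proof.
apply/rowP => -[[|i] ilt8]; rewrite !mxE /= ?mulr0 ?add0r //.
by rewrite rmorphD /= mulrDl mulr1 mul1r.
Qed.

(** The parity checks of the Hamming code, solved for the coordinates 0, 1,
    2, 4 in terms of the information coordinates 3, 5, 6, 7. *)
Definition hamming_parity (y : seq int) : bool :=
  [&& (2 %| y`_0 + y`_5 + y`_6 + y`_7)%Z,
      (2 %| y`_1 + y`_3 + y`_5 + y`_6)%Z,
      (2 %| y`_2 + y`_3 + y`_6 + y`_7)%Z
    & (2 %| y`_4 + y`_3 + y`_5 + y`_7)%Z].

(** Twice the coordinates of the combination of the generators with
    coefficients [c]. *)
Definition double_comb (c : nat -> int) : seq int :=
  [:: 2 * c 0 - c 5 - c 6 - c 7;
      2 * c 1 + c 4 - c 5 + c 6;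
      2 * c 2 + c 4 - c 6 + c 7;
      c 4;
      - 2 * c 3 + c 4 - c 5 + c 7;
      c 5; c 6; c 7].

Lemma oct_alpha_comb (c : nat -> int) :
  \sum_(i < 8) oct_alpha`_i *~ c i = half_row (double_comb c).
Proof.
rewrite !big_ord_recl big_ord0 /= /bump /=.
apply/rowP => i; rewrite -!scaler_int !mxE.
by case: i => [[|[|[|[|[|[|[|[|i]]]]]]]] //= ilt8];
   rewrite ?mxE /= ?rmorphD ?rmorphB ?rmorphM /=; field.
Qed.

Lemma integral_octonionP (x : octonion) :
  integral_octonion x <->
  exists y, [/\ size y = 8%N, hamming_parity y & x = half_row y].
Proof.
split=> [[c ->]|[y [sy py ->]]].
  exists (double_comb (fun i => c (inord i))); split=> //.
    by rewrite /hamming_parity /=; lia.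
  by rewrite -oct_alpha_comb; apply: eq_bigr => i _; rewrite inord_val.
suff [c ->] : exists c : nat -> int, y = double_comb c.
  exists [ffun i : 'I_8 => c i].
  by rewrite -oct_alpha_comb; apply: eq_bigr => i _; rewrite ffunE.
move: py; rewrite (size8P _ 0 _ sy) /hamming_parity /=.
move: y`_0 y`_1 y`_2 y`_3 y`_4 y`_5 y`_6 y`_7 => y0 y1 y2 y3 y4 y5 y6 y7.
case/and4P=> p0 p1 p2 p4.
(* The parity checks make the four divisions by 2 exact. *)
exists (nth 0 [:: ((y0 + y5 + y6 + y7) %/ 2)%Z; ((y1 - y3 + y5 - y6) %/ 2)%Z;
                  ((y2 - y3 + y6 - y7) %/ 2)%Z; ((y3 - y4 - y5 + y7) %/ 2)%Z;
                  y3; y5; y6; y7]).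
by rewrite /double_comb /=; congr [:: _; _; _; _; _; _; _; _]; lia.
Qed.

Fixpoint sign_words (n : nat) : seq (seq int) :=
  if n is m.+1 then [seq a :: s | a <- [:: -1; 0; 1], s <- sign_words m]
  else [:: [::]].

Lemma size_sign_words n s : s \in sign_words n -> size s = n.
Proof.
elim: n s => [|n IHn] s; first by rewrite inE => /eqP ->.
by case/allpairsP => -[a t] [_ /IHn <- ->].
Qed.

Lemma sqnorm_ge0 (s : seq int) : 0 <= sqnorm s.
Proof. by elim: s => //= a s IHs; rewrite addr_ge0 ?sqr_ge0. Qed.

Lemma mem_sign_words_sqnorm (s : seq int) :
  sqnorm s <= 3 -> s \in sign_words (size s).
Proof.
elim: s => // a s IHs; rewrite [sqnorm _]/= => le3.
have s_ge0 := sqnorm_ge0 s; have a2_ge0 := sqr_ge0 a.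
apply: (allpairs_f cons); last by apply: IHs; lia.
by rewrite !inE; nia.
Qed.

Definition half_roots : seq (seq int) :=
  [seq s <- sign_words 7 | hamming_parity (1 :: s) && (sqnorm s == 3)].

Lemma size_half_roots : size half_roots = 56%N.
Proof. by vm_compute. Qed.

Lemma half_roots_uniq : uniq half_roots.
Proof. by vm_compute. Qed.

Lemma mem_half_roots (s : seq int) :
  s \in half_roots <->
  [/\ size s = 7%N, hamming_parity (1 :: s) & sqnorm s = 3].
Proof.
rewrite mem_filter; split=> [/andP[/andP[ps /eqP ns]] /size_sign_words //|].
move=> [ss ps ns]; rewrite ps ns eqxx -ss /=.
by apply: mem_sign_words_sqnorm; rewrite ns.
Qed.

Lemma oct_norm_half_row_eq1 (s : seq int) : size s = 7%N ->
  oct_norm (half_row (1 :: s)) = 1 <-> sqnorm s = 3.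
Proof.
move=> ss; rewrite oct_norm_half_row /= ?ss // expr1n rmorphD /=.
split=> [n1|->]; last by field.
by apply: (@intr_inj rat); lra.
Qed.

Lemma card_eq_uniq_seq (T : choiceType) (s : seq T) :
  uniq s -> [set` s] #= `I_(size s).
Proof.
move=> us; have -> : [set` s] = [set` seq_fset tt s].
  by apply/seteqP; split=> x; rewrite !mksetE seq_fsetE.
by apply/card_eq_fsetP; rewrite size_seq_fset undup_id.
Qed.

Theorem proposition3p6 :
  [set x : octonion | [/\ imaginary x,
                          integral_octonion (oct_half + x)
                        & oct_norm (oct_half + x) = 1]] #= `I_56.
Proof.
set A := (X in X #= _).
pose roots := [seq half_row (0 :: s) | s <- half_roots].
have -> : A = [set` roots].
  apply/seteqP; split=> x /=.
    move=> [im_x /integral_octonionP[[|a s] [// [ss] ps xE] n1]].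
    have {xE} xE : x = half_row (a - 1 :: s).
      apply: (addrI oct_half); rewrite half_rowDhalf xE.
      by congr (half_row (_ :: s)); ring.
    move: im_x ps n1; rewrite xE => /imaginary_half_row a1.
    rewrite half_rowDhalf (_ : a = 1); last by lia.
    move=> ps /(oct_norm_half_row_eq1 _ ss) ns.
    by rewrite subrr; apply/mapP; exists s => //; apply/mem_half_roots.
  case/mapP => s /mem_half_roots[ss ps ns] ->; split.
  - exact/imaginary_half_row.
  - rewrite half_rowDhalf addr0; apply/integral_octonionP.
    by exists (1 :: s); rewrite /= ss.
  - by rewrite half_rowDhalf addr0; apply/oct_norm_half_row_eq1.
have <- : size roots = 56%N by rewrite size_map size_half_roots.
apply: card_eq_uniq_seq; rewrite map_inj_in_uniq ?half_roots_uniq //.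
move=> s t /mem_half_roots[ss _ _] /mem_half_roots[st _ _].
by move/half_row_inj; rewrite /= ss st => /(_ erefl erefl) [].
Qed.
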